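(* Let $\ell$ be a locally bounded positive function slowly varying at infinity, and let $q$ be a positive function, defined in a neighborhood of infinity, such that $q(t)=o(t)$ and $q(t)\to\infty$ as $t\to\infty$. Then $$\int_0^{\infty}y^{q(t)-1}e^{-y}\ell(t/y)\,\mathrm{d}y\ \sim\ \Gamma(q(t))\,\ell(t/q(t)),\qquad t\to\infty.$$
   Context: $\Gamma$ is the Euler gamma-function. Slow variation at infinity is meant in the usual sense: $\ell(\lambda t)/\ell(t)\to1$ as $t\to\infty$ for every $\lambda>0$. The notation $f(t)\sim g(t)$ means $\lim_{t\to\infty}f(t)/g(t)=1$. *)

(* Defs.v *)
From HB Require Import structures.
From mathcomp Require Import all_boot all_order all_algebra.
From mathcomp Require Import all_classical all_reals all_analysis.

Set Implicit Arguments.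
Unset Strict Implicit.
Unset Printing Implicit Defensive.

Import Order.TTheory GRing.Theory Num.Theory.
Import numFieldNormedType.Exports.

Local Open Scope classical_set_scope.
Local Open Scope ring_scope.

(* [R] with the sigma-algebra of Lebesgue (not only Borel) measurable sets;
   this is the domain of [completed_lebesgue_measure]. *)
Notation lebesgueTypeR R :=
  (caratheodory_type (@wlength R idfun)^*%mu).

Definition lebesgue_measurable_fun (R : realType) (D : set R) (f : R -> R) :
    Prop :=
  measurable_fun (D : set (lebesgueTypeR R)) (f : lebesgueTypeR R -> R).

(* Real-valued: an infinite integral is sent to 0, so an equivalence
   [asymp_equiv] with such an integral on the left forces it to be finite
   for all large arguments. *)
Definition integral_0oo (R : realType) (f : R -> R) : R :=
  \int[@completed_lebesgue_measure R]_(y in `]0, +oo[) f y.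

Definition Gamma (R : realType) (s : R) : R :=
  integral_0oo (fun y => y `^ (s - 1) * expR (- y)).

Definition slowly_varying (R : realType) (l : R -> R) : Prop :=
  forall a : R, 0 < a -> l (a * t) / l t @[t --> +oo] --> (1 : R).

Definition asymp_equiv (R : realType) (f g : R -> R) : Prop :=
  f t / g t @[t --> +oo] --> (1 : R).

(* Main.v *)
Require Import Defs.
From mathcomp Require Import all_boot all_order all_algebra.
From mathcomp Require Import all_classical all_reals all_analysis.
From mathcomp Require Import measurable_realfun ring lra.
Import Order.TTheory GRing.Theory Num.Theory.
Import numFieldNormedType.Exports.
Local Open Scope classical_set_scope.
Local Open Scope ring_scope.

(** Write [Q = q t], [v = t / Q] and [z = y / Q].  Under the probability density
proportional to [y `^ (Q - 1) * expR (- y)] the variable [z] has mean 1 and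
variance [1 / Q], so for large [Q] the integral only sees [z] close to 1, where
[l (t / y) = l (v / z)] is close to [l v] because [l] varies slowly and
[v] tends to infinity.

The closeness of [l (v / z)] and [l v] is needed uniformly in [z].  For [z] in a
compact subset of the positive half-line it is the uniform convergence theorem
[slowly_varying_uniform].  For other [z] it is replaced by the Potter bound
[slowly_varying_potter], which controls [l (v / z) / l v] by a multiple of
[z + 1 / z] as long as [v / z] stays large, and by local boundedness when it does
not.  All these estimates are condensed into two pointwise envelopes,
[slowly_varying_lower] and [slowly_varying_upper], valid for every [z > 0]:
- [l (v / z) >= l v / (1 + eta) * (1 - 4 * (z - 1) ^+ 2)],
- [l (v / z) <= l v * (1 + eta + C * ((z + z^-1) * (z - 1) ^+ 2))].

Multiplied by [y `^ (Q - 1) * expR (- y)], the envelopes are linear combinations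
of the gamma integrands of parameters [Q - 1], ..., [Q + 3].  Hence their
integrals follow exactly from the recurrence [GammaD1]; they equal
[Gamma Q * l v] times [(1 - 4 / Q) / (1 + eta)] and
[1 + eta + C * (1 / Q + 2 / Q ^+ 2 + 1 / (Q - 1))] respectively, and both factors
come within [O(eta)] of 1 as [Q] tends to infinity.

The integrand containing [l (t / y)] is compared with the envelopes by
[le_integral_mono], the monotonicity of the integral on arbitrary functions; a
measurability proof for [y |-> l (t / y)] is thus avoided. *)

(** * Dilations of Lebesgue measurable sets *)

Notation outer_lebesgue R := ((@wlength R idfun)^*%mu).

Lemma preimage_scale_itvoc (R : realType) (c a b : R) : 0 < c ->
  ( *%R c) @^-1` `]a, b]%classic = `]a / c, b / c]%classic.
Proof.
move=> c0; apply/seteqP; split => x /=; rewrite !in_itv/=.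
  by rewrite ler_pdivlMr// ltr_pdivrMr// (mulrC x).
by rewrite ler_pdivlMr// ltr_pdivrMr// (mulrC x).
Qed.

Lemma wlength_preimage_scale (R : realType) (c : R) (A : set R) :
  0 < c -> ocitv A ->
  wlength idfun (( *%R c) @^-1` A) = (c^-1%:E * wlength idfun A)%E.
Proof.
move=> c0 [[a b] _ <-] /=.
rewrite preimage_scale_itvoc// !wlength_itv/= !lte_fin ltr_pM2r ?invr_gt0//.
case: ifP => _; last by rewrite mule0.
by rewrite -!EFinD -EFinM mulrDr mulrN !(mulrC c^-1).
Qed.

(** Dilating a countable cover by half-open intervals gives a cover of the
dilated set whose total length is scaled. *)
Lemma outer_lebesgue_scale (R : realType) (c : R) (A : set R) : 0 < c ->
  (outer_lebesgue R (( *%R c) @^-1` A) <= c^-1%:E * outer_lebesgue R A)%E.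
Proof.
move=> c0.
rewrite [leRHS](_ : _ = ereal_inf [set (c^-1%:E * x)%E | x in
   [set (\sum_(k <oo) wlength idfun (F k))%E | F in @measurable_cover _ (ocitv_type R) A]]);
  last by rewrite ereal_inf_pZl ?invr_gt0.
apply: le_ereal_inf_tmp => _ [_ [F [mF AF] <-] <-].
apply: ereal_inf_lbound; exists (fun k => ( *%R c) @^-1` F k).
  split => [i|x /AF[i _ Fi]]; last by exists i.
  have [[a b] _ <-] := mF i => /=.
  rewrite preimage_scale_itvoc//; exact: is_ocitv.
rewrite -nneseriesZl; last by move=> i _; exact: wlength_ge0.
by apply: eq_eseriesr => i _; rewrite wlength_preimage_scale//; exact: mF.
Qed.

(** The outer measure scales under dilations in both directions, so the
Caratheodory criterion for [A] tested on [Y] becomes the criterion for the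
dilated [A] tested on the dilated [Y]. *)
Lemma lebesgue_measurable_scale (R : realType) (c : R) (A : set R) : 0 < c ->
  measurable (A : set (lebesgueTypeR R)) ->
  measurable (( *%R c) @^-1` A : set (lebesgueTypeR R)).
Proof.
move=> c0 mA; apply: le_caratheodory_measurable => X.
set Y := ( *%R c^-1) @^-1` X.
have XY : X = ( *%R c) @^-1` Y.
  by apply/seteqP; split => x; rewrite /Y /preimage/= mulKf ?gt_eqF.
rewrite {1 2}XY preimage_setC -!preimage_setI.
apply: (@le_trans _ _ (c^-1%:E * outer_lebesgue R Y)%E).
  rewrite (mA Y) ge0_muleDr ?outer_measure_ge0//.
  by apply: leeD; exact: outer_lebesgue_scale.
rewrite -lee_pdivlMl ?invr_gt0// invrK /Y.
by rewrite -{2}(invrK c); apply: outer_lebesgue_scale; rewrite invr_gt0.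
Qed.

(** * Slowly varying functions *)

Lemma locally_bounded_itv (R : realType) (l : R -> R) (X : R) :
  [locally [bounded l x | x in `[0, +oo[]] ->
  exists M, forall x, 0 <= x <= X -> `|l x| <= M.
Proof.
move=> lb.
have : \forall M \near +oo, `[0, X]%classic `<=` [set x | 0 <= x -> `|l x| <= M].
  apply: (compact_near_coveringP `[0, X]%classic).1; first exact: segment_compact.
  move=> x /=; rewrite in_itv/= => /andP[x0 _].
  have [|M0 HM0] := @filter_ex _ (pinfty_nbhs R) _ _ (lb x _).
    by rewrite /= in_itv/= x0.
  exists ([set y | 0 <= y -> `|l y| <= M0], [set M | M0 <= M]) => /=.
    split; last by apply: nbhs_pinfty_ge; exact: num_real.
    move: HM0; rewrite /within/=; apply: filterS => y H y0.
    by apply: H; rewrite in_itv/= y0.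
  by move=> [y M] /= [yM0 M0M] y0; exact: le_trans (yM0 y0) M0M.
move=> /(@filter_ex _ (pinfty_nbhs R))[M HM]; exists M => x xX.
by apply: HM => /=; rewrite ?in_itv//; case/andP: xX.
Qed.

Section slowly_varying.
Context {R : realType} (l : R -> R).
Hypothesis l_gt0 : forall x, 0 < x -> 0 < l x.
Hypothesis l_meas : lebesgue_measurable_fun `]0, +oo[ l.
Hypothesis l_sv : slowly_varying l.

(** The factors in [[1, b]] that change the value of [l] at [u m] by a relative
error of at most [e], for all [m] from [n] on. *)
Let stable (u : nat -> R) (e b : R) (n : nat) : set R :=
  `[1, b] `&` \bigcap_(m in [set m | (n <= m)%N])
    ( *%R (u m)) @^-1` (`]0, +oo[ `&` l @^-1` `[(1 - e) * l (u m), (1 + e) * l (u m)]).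

Let measurable_stable u e b n : (forall m, 0 < u m) ->
  measurable (stable u e b n : set (lebesgueTypeR R)).
Proof.
move=> u0; apply: measurableI.
  by apply: sub_caratheodory; exact: measurable_itv.
apply: bigcap_measurableType => m _; apply: lebesgue_measurable_scale => //.
apply: l_meas; last exact: measurable_itv.
by apply: sub_caratheodory; exact: measurable_itv.
Qed.

(** Pointwise slow variation says that the sets [stable u e b n] increase to the
whole of [[1, b]] with [n]; continuity of the measure then makes the exceptional
set small. *)
Let stable_large u e b (d : R) : (forall m, 0 < u m) -> u n @[n --> \oo] --> +oo ->
  0 < e -> 1 < b -> 0 < d ->
  \forall n \near \oo, ((b - 1 - d)%:E < outer_lebesgue R (stable u e b n))%E.
Proof.
move=> u0 uoo e0 b1 d0.
have cup : \bigcup_n stable u e b n = `[1, b]%classic.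
  apply/seteqP; split => [x [n _ []]//|x xb].
  have x0 : 0 < x by move: xb => /=; rewrite in_itv/= => /andP[/(lt_le_trans ltr01)].
  have : l (x * u n) / l (u n) @[n --> \oo] --> (1 : R).
    by apply: (cvg_comp u (fun t => l (x * t) / l t)); [exact: uoo|exact: l_sv].
  move/cvgrPdist_le => /(_ _ e0)[n _ Hn].
  exists n => //; split => // m /= nm.
  have := Hn m nm; rewrite /= ler_norml => /andP[h1 h2].
  have lu : 0 < l (u m) by exact: l_gt0.
  split; first by rewrite in_itv/= andbT mulr_gt0.
  rewrite /= in_itv/= (mulrC (u m)) -(ler_pdivrMr _ _ lu) -(ler_pdivlMr _ _ lu).
  by apply/andP; split; lra.
have : outer_lebesgue R (stable u e b n) @[n --> \oo] --> (b - 1)%:E.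
  have <- : outer_lebesgue R (\bigcup_n stable u e b n) = (b - 1)%:E.
    by rewrite cup -[LHS]/(lebesgue_measure _) lebesgue_measure_itv/= lte_fin b1.
  apply: (@nondecreasing_cvg_mu _ (lebesgueTypeR R) R (@completed_lebesgue_measure R)).
  - by move=> i; exact: measurable_stable.
  - by apply: bigcupT_measurable => i; exact: measurable_stable.
  - move=> n m nm; apply/subsetPset; apply: setIS => x h k /= mk.
    by apply: h => /=; exact: leq_trans mk.
move=> h; have db : ((b - 1 - d)%:E < (b - 1)%:E)%E by rewrite lte_fin; lra.
exact: (h _ (open_ereal_gt' db)).
Qed.

(** Uniform convergence theorem.  Given counterexamples [t n] and [a n], most
points [z] of [[1, 8]] are stable for the sequence [t], and most points [s] of
[[1, 4]] are stable for the sequence [a n * t n].  The dilation by [a n] maps the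
latter into [[1, 8]] without losing measure, so some [z = a n * s] is of both
kinds.  Then [l (t n * z)] is close to [l (t n)] and to [l (a n * t n)], which
contradicts the choice of [t n] and [a n]. *)
Lemma slowly_varying_uniform (eta : R) : 0 < eta ->
  exists2 X, 0 < X & forall t a, X <= t -> 1 <= a <= 2 ->
    l (a * t) <= (1 + eta) * l t /\ l t <= (1 + eta) * l (a * t).
Proof.
move=> eta0; apply: contrapT => noX.
have /choice[w Hw] : forall n : nat, exists w : R * R, [/\ n.+1%:R <= w.1, 1 <= w.2 <= 2 &
    ~ (l (w.2 * w.1) <= (1 + eta) * l w.1 /\ l w.1 <= (1 + eta) * l (w.2 * w.1))].
  move=> n; apply: contrapT => H; apply: noX; exists n.+1%:R => // t a tn a12.
  by apply: contrapT => H2; apply: H; exists (t, a).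
pose t n := (w n).1; pose a n := (w n).2.
have t0 n : 0 < t n by have [/(lt_le_trans _)-> //] := Hw n.
have a1 n : 1 <= a n by have [_ /andP[]] := Hw n.
have a2 n : a n <= 2 by have [_ /andP[]] := Hw n.
have at0 n : 0 < a n * t n by rewrite mulr_gt0// (lt_le_trans ltr01).
have too : t n @[n --> \oo] --> +oo.
  apply/cvgryPge => A; near=> n; have [+ _ _] := Hw n; apply: le_trans.
  rewrite (@le_trans _ _ n%:R) ?ler_nat//; near: n; exact: nbhs_infty_ger.
have atoo : a n * t n @[n --> \oo] --> +oo.
  by apply: ger_cvgy too; near=> n; rewrite ler_peMl// ltW.
(* This [e] solves (1 + e) / (1 - e) = 1 + eta, the loss of two comparisons. *)
pose e := eta / (2 + eta).
have e0 : 0 < e by rewrite divr_gt0// ltr_wpDl.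
have e1 : e < 1 by rewrite /e ltr_pdivrMr; lra.
have eE : (1 + e) = (1 + eta) * (1 - e) by rewrite /e; field; apply: lt0r_neq0; lra.
have V := @stable_large t e 8 1 t0 too e0 _ ltr01.
have W := @stable_large (fun n => a n * t n) e 4 1 at0 atoo e0 _ ltr01.
have [n] : exists n, ((8 - 1 - 1)%:E < outer_lebesgue R (stable t e 8 n))%E /\
    ((4 - 1 - 1)%:E < outer_lebesgue R (stable (fun n => a n * t n)%R e 4 n))%E.
  apply: (@filter_ex _ \oo); apply: filterI; [apply: V|apply: W]; lra.
set V' := stable t e 8 n; set W' := stable _ e 4 n => -[VL WL].
pose aW := ( *%R (a n)^-1) @^-1` W'.
have an0 : 0 < a n by exact: lt_le_trans (a1 n).
have aWL : (outer_lebesgue R W' <= outer_lebesgue R aW)%E.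
  have -> : W' = ( *%R (a n)) @^-1` aW.
    by apply/seteqP; split => x; rewrite /aW /preimage/= mulKf ?gt_eqF.
  apply: (le_trans (@outer_lebesgue_scale _ _ aW an0)).
  by rewrite gee_pMl ?outer_measure_ge0// lee_fin invf_le1.
have [z [zV zW]] : exists z, V' z /\ W' ((a n)^-1 * z).
  apply: contrapT => H.
  have mV : measurable (V' : set (lebesgueTypeR R)) by exact: measurable_stable.
  have : outer_lebesgue R `[1, 8]%classic = (outer_lebesgue R (`[1%R, 8%R] `&` V')
      + outer_lebesgue R (`[1%R, 8%R] `&` ~` V'))%E by exact: mV.
  have -> : outer_lebesgue R `[1, 8]%classic = (8 - 1)%:E.
    by rewrite -[LHS]/(lebesgue_measure _) lebesgue_measure_itv/= lte_fin ltr1n.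
  (* The measures of [V'] and [aW] exceed 6 and 2, and 6 + 2 > 7. *)
  apply/eqP; rewrite lt_eqF//.
  have : (outer_lebesgue R V' <= outer_lebesgue R (`[1%R, 8%R] `&` V'))%E.
    by apply: le_outer_measure => x Vx; split => //; case: Vx.
  have : (outer_lebesgue R aW <= outer_lebesgue R (`[1%R, 8%R] `&` ~` V'))%E.
    apply: le_outer_measure => x aWx; split; last by move=> Vx; apply: H; exists x.
    case: aWx => + _; rewrite /= !in_itv/= mulrC ler_pdivlMr// ler_pdivrMr// mul1r.
    move=> /andP[h1 h2]; rewrite (le_trans (a1 n) h1)/= (le_trans h2)//.
    by have := a2 n; lra.
  move=> h1 h2; rewrite (@lt_trans _ _ ((8 - 1 - 1)%:E + (4 - 1 - 1)%:E)%E)//.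
    by rewrite -EFinD lte_fin; lra.
  apply: lteD; first exact: lt_le_trans h2.
  by apply: lt_le_trans h1; exact: lt_le_trans aWL.
have [_ _ /=] := Hw n; rewrite -/(t n) -/(a n); apply.
have [_ /(_ n (leqnn n)) [_ /=]] := zV; rewrite in_itv/= => /andP[v1 v2].
have [_ /(_ n (leqnn n)) [_ /=]] := zW; rewrite in_itv/=.
rewrite (mulrC (a n)) -mulrA mulVKf ?gt_eqF// => /andP[w1 w2].
have e10 : 0 < 1 - e by rewrite subr_gt0.
split; rewrite -(ler_pM2l e10) mulrA (mulrC (1 - e) (1 + eta)) -eE.
  exact: le_trans v2.
exact: le_trans w2.
Unshelve. all: by end_near. Qed.

(** Potter bound with exponent 1: by the uniform convergence theorem with
[eta = 1], multiplying the argument by at most 2 changes [l] by a factor between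
1/2 and 2, and this is iterated along the multiples of [u] by powers of 2. *)
Lemma slowly_varying_potter : exists2 X, 0 < X & forall u v, X <= u -> X <= v ->
    l v <= 2 * (v / u + u / v) * l u.
Proof.
have [X X0 HX] := @slowly_varying_uniform 1 ltr01.
have base u v : X <= u -> u <= v -> v <= 2 * u ->
    l v <= 2 * (v / u) * l u /\ l u <= 2 * (v / u) * l v.
  move=> Xu uv v2; have u0 := lt_le_trans X0 Xu.
  have [lu lv] := (l_gt0 _ u0, l_gt0 _ (lt_le_trans u0 uv)).
  have vu1 : 1 <= v / u by rewrite ler_pdivlMr// mul1r.
  have := HX u (v / u) Xu; rewrite vu1 ler_pdivrMr// v2 divfK ?gt_eqF//.
  move=> /(_ isT)[h1 h2].
  by split; [apply: (le_trans h1)|apply: (le_trans h2)];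
    rewrite ler_pM2r// ler_peMr//; lra.
have H n : forall u v, X <= u -> u <= v -> v <= 2 ^+ n.+1 * u ->
    l v <= 2 * (v / u) * l u /\ l u <= 2 * (v / u) * l v.
  elim: n => [|n IH] u v Xu uv vn; first exact: base.
  have u0 := lt_le_trans X0 Xu; have v0 := lt_le_trans u0 uv.
  have [v2|v2] := leP v (2 * u); first exact: base.
  have [||h1 h2] := IH (2 * u) v _ (ltW v2).
  - lra.
  - by rewrite mulrA -exprSr.
  have [|k1 k2] := HX u 2 Xu; first lra.
  have lv := l_gt0 _ v0; have lu := l_gt0 _ u0.
  have vu0 : 0 < v / u by rewrite divr_gt0.
  have E : 2 * (v / (2 * u)) = v / u by field; apply: lt0r_neq0.
  by rewrite E in h1 h2; split; nra.
exists X => // u v Xu Xv.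
have u0 := lt_le_trans X0 Xu; have v0 := lt_le_trans X0 Xv.
have vu : 0 < v / u by rewrite divr_gt0.
have uv : 0 < u / v by rewrite divr_gt0.
have pow2 (r : R) : 0 < r -> exists n, r <= 2 ^+ n.+1.
  move=> r0; exists (Num.truncn r); apply: (le_trans (ltW (truncnS_gt r))).
  by rewrite -natrX ler_nat ltnW// ltn_expl.
have [lu lv] := (l_gt0 _ u0, l_gt0 _ v0).
have [le_uv|/ltW le_vu] := leP u v.
  have [n] := pow2 _ vu; rewrite ler_pdivrMr// => vn.
  have [h _] := H n _ _ Xu le_uv vn.
  by apply: (le_trans h); rewrite ler_pM2r// ler_pM2l// lerDl ltW.
have [n] := pow2 _ uv; rewrite ler_pdivrMr// => un.
have [_ h] := H n _ _ Xv le_vu un.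
by apply: (le_trans h); rewrite ler_pM2r// ler_pM2l// lerDr ltW.
Qed.

(** The uniform convergence theorem is applied at the smaller of [v] and [v / z]. *)
Lemma slowly_varying_half (eta : R) : 0 < eta -> exists2 V, 0 < V &
  forall v z, V <= v -> 2^-1 <= z <= 2 ->
    l (v / z) <= (1 + eta) * l v /\ l v <= (1 + eta) * l (v / z).
Proof.
move=> eta0; have [X X0 HX] := @slowly_varying_uniform eta eta0.
exists (2 * X) => [|v z Vv /andP[z1 z2]]; first by rewrite mulr_gt0.
have z0 : 0 < z by lra.
have [z_le1|/ltW z_ge1] := leP z 1.
  have := HX v z^-1; rewrite (mulrC z^-1); apply; first lra.
  by rewrite invf_ge1// z_le1 -[leRHS]invrK lef_pV2// posrE.
have [||h1 h2] := HX (v / z) z.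
- by rewrite ler_pdivlMr//; nra.
- by rewrite z_ge1.
by move: h1 h2; rewrite mulrC divfK ?gt_eqF.
Qed.

(** This is what lets [(z - 1) ^+ 2] absorb every estimate made away from
[z = 1]. *)
Lemma sq_dist1_ge (z : R) : ~~ (2^-1 <= z <= 2) -> 1 <= 4 * (z - 1) ^+ 2.
Proof. by rewrite negb_and -!ltNge expr2 => /orP[] z2; nra. Qed.

(** On [[1/2, 2]] this is uniform convergence; elsewhere the left-hand side is
nonpositive. *)
Lemma slowly_varying_lower (eta : R) : 0 < eta -> exists2 V, 0 < V &
  forall v z, V <= v -> 0 < z ->
    l v / (1 + eta) * (1 - 4 * (z - 1) ^+ 2) <= l (v / z).
Proof.
move=> eta0; have [V V0 HV] := @slowly_varying_half eta eta0.
exists V => // v z Vv z0; have v0 := lt_le_trans V0 Vv.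
have e0 : 0 < 1 + eta by lra.
have lv := l_gt0 _ v0; have lvz : 0 < l (v / z) by apply: l_gt0; rewrite divr_gt0.
have lve : 0 < l v / (1 + eta) by rewrite divr_gt0.
have [zz|/sq_dist1_ge zz] := boolP (2^-1 <= z <= 2).
  have [_ h] := HV v z Vv zz.
  apply: (@le_trans _ _ (l v / (1 + eta))); last by rewrite ler_pdivrMr// mulrC.
  by rewrite ler_piMr ?(ltW lve)// lerBlDr lerDl mulr_ge0// sqr_ge0.
by apply: le_trans (ltW lvz); rewrite pmulr_rle0// subr_le0.
Qed.

(** Away from [[1/2, 2]] the Potter bound applies if [v / z] is large.  Otherwise
[l (v / z)] is bounded by a constant, while [z] is at least of the order of [v];
as the Potter bound also prevents [l v] from decaying faster than [1 / v], the
constant is dominated by a multiple of [z * l v]. *)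
Lemma slowly_varying_upper (eta : R) :
  [locally [bounded l x | x in `[0, +oo[]] -> 0 < eta ->
  exists2 C, 0 < C & exists2 V, 0 < V & forall v z, V <= v -> 0 < z ->
    l (v / z) <= l v * (1 + eta + C * ((z + z^-1) * (z - 1) ^+ 2)).
Proof.
move=> l_locbnd eta0; have [V V0 HV] := @slowly_varying_half eta eta0.
have [X X0 HX] := slowly_varying_potter.
have [M HM] := locally_bounded_itv _ _ X l_locbnd.
have lX := l_gt0 _ X0.
have M0 : 0 <= M by apply: le_trans (normr_ge0 _) (HM X _); rewrite lexx ltW.
exists (8 + 16 * (M / l X)); first by rewrite ltr_wpDr// mulr_ge0// divr_ge0// (ltW lX).
exists (Num.max V (2 * X)); first by rewrite lt_max V0.
move=> v z; rewrite ge_max => /andP[Vv Xv] z0; have v0 := lt_le_trans V0 Vv.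
have lv := l_gt0 _ v0; have lvz : 0 < l (v / z) by apply: l_gt0; rewrite divr_gt0.
set C := 8 + _; set S := (z + z^-1) * _.
have zV0 : 0 < z^-1 by rewrite invr_gt0.
have S0 : 0 <= S by rewrite mulr_ge0 ?sqr_ge0// addr_ge0 ?ltW.
have ML : 0 <= M / l X by rewrite divr_ge0 ?M0 ?(ltW lX).
have [zz|/sq_dist1_ge zz] := boolP (2^-1 <= z <= 2).
  have [h _] := HV v z Vv zz.
  apply: (le_trans h); rewrite mulrC ler_pM2l// lerDl mulr_ge0// /C.
  by rewrite addr_ge0// mulr_ge0.
have zS : z + z^-1 <= 4 * S.
  by rewrite /S mulrCA ler_peMr// addr_ge0 ?ltW.
suff : l (v / z) <= l v * (C * S).
  move=> h; apply: (le_trans h); rewrite ler_pM2l//; lra.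
have [Xvz|vzX] := leP X (v / z).
  have := HX v (v / z) _ Xvz.
  have -> : v / z / v + v / (v / z) = z + z^-1 by field; rewrite !gt_eqF.
  move=> /(_ _)/le_trans; apply; first lra.
  rewrite mulrC ler_pM2l// /C; nra.
have vX : v / X < z by rewrite ltr_pdivrMr// mulrC -ltr_pdivrMr.
have h := HX v X ltac:(lra) (lexx X).
have h2 : X / v + v / X <= 2 * z.
  have -> : X / v = (v / X)^-1 by rewrite invf_div.
  have : 1 <= v / X by rewrite ler_pdivlMr//; lra.
  move=> vX1; have : (v / X)^-1 <= 1 by rewrite invf_le1//; lra.
  lra.
have lXz : l X <= 4 * z * l v.
  by apply: (le_trans h); rewrite ler_pM2r//; lra.
have : l (v / z) <= M.
  apply: (le_trans (ler_norm _)); apply: HM; rewrite (ltW vzX) andbT.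
  by rewrite divr_ge0// ltW.
move=> /le_trans; apply.
have -> : M = M / l X * l X by rewrite divfK ?gt_eqF.
apply: (@le_trans _ _ (M / l X * (4 * z * l v))); first by rewrite ler_wpM2l.
rewrite mulrA mulrC ler_pM2l// /C.
set m := M / l X in ML *; nra.
Qed.

End slowly_varying.

(** * Gamma integrals *)

(** The integral of a nonnegative function, measurable or not, is the supremum of
the integrals of the simple functions below it, hence monotone; positive and
negative parts reduce the general case to this one. *)
Lemma le_integral_mono d (T : measurableType d) (R : realType)
    (m : {measure set T -> \bar R}) (D : set T) (f g : T -> \bar R) :
  (forall x, D x -> (f x <= g x)%E) ->
  (\int[m]_(x in D) f x <= \int[m]_(x in D) g x)%E.
Proof.
move=> fg; have fgD x : ((f \_ D) x <= (g \_ D) x)%E.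
  by rewrite !patchE; case: ifPn => //; rewrite inE; exact: fg.
rewrite /integral; apply: leeB; apply: le_ereal_sup => _ [h hf <-];
  exists h => //= x; apply: (le_trans (hf x)).
- by rewrite !funeposE ge_max !le_max fgD lexx orbT.
- by rewrite !funenegE ge_max !le_max leeN2 fgD lexx orbT.
Qed.

Section gamma.
Context {R : realType}.
Implicit Types s y b : R.

Definition gamma_kernel s y : R := y `^ (s - 1) * expR (- y).

Lemma gamma_kernel_ge0 s y : 0 <= gamma_kernel s y.
Proof. by rewrite mulr_ge0 ?powR_ge0 ?expR_ge0. Qed.

Lemma gamma_kernelD1 s y : 0 < y -> gamma_kernel (s + 1) y = y * gamma_kernel s y.
Proof.
move=> y0; rewrite /gamma_kernel addrK mulrA; congr (_ * _).
rewrite -[in LHS](subrKC 1 s) [LHS]powRD; last by apply/implyP => _; rewrite gt_eqF.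
by rewrite powRr1// ltW.
Qed.

Lemma measurable_gamma_kernel s : measurable_fun setT (gamma_kernel s).
Proof.
apply: measurable_funM.
  apply: (measurableT_comp (measurable_powR _)); exact: measurable_id.
by apply: measurableT_comp; [exact: measurable_expR|exact: measurable_funN].
Qed.

Lemma measurable_EFin_gamma_kernel s (D : set R) :
  measurable_fun D (fun y => (gamma_kernel s y)%:E).
Proof.
by apply/measurable_EFinP; apply: measurable_funTS; exact: measurable_gamma_kernel.
Qed.

(** A Taylor term of the exponential of degree larger than [s] beats the power;
this makes the boundary term of the integration by parts vanish at infinity. *)
Lemma powR_expRN_bound s : exists2 C : R, 0 < C &
  forall b, 1 <= b -> b `^ s * expR (- b) <= C / b.
Proof.
pose k := (Num.truncn s).+1.
have sk : s <= k%:R by exact/ltW/truncnS_gt.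
exists (k.+1)`!%:R => [|b b1]; first by rewrite ltr0n fact_gt0.
have b0 : 0 < b by exact: lt_le_trans b1.
apply: (@le_trans _ _ (b ^+ k * expR (- b))).
  by rewrite ler_pM2r ?expR_gt0// -powR_mulrn ?ler_powR// ltW.
rewrite expRN ler_pdivrMr ?expR_gt0// mulrAC ler_pdivlMr// -exprSr.
rewrite -ler_pdivrMl ?ltr0n ?fact_gt0// mulrC.
by apply: le_trans (expR_ge1Dxn k (ltW b0)); rewrite lerDr.
Qed.

Lemma continuous_powR0 s b : 0 <= s -> 0 < b ->
  {within `[0, b], continuous (fun y => y `^ s)}.
Proof.
move=> s0 b0.
have cont y : 0 < y -> {for y, continuous (fun y => y `^ s)}.
  move=> y0; apply/differentiable_continuous/derivable1_diffP.
  by apply: derivable_powR; rewrite in_itv/= andbT.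
apply/(continuous_within_itvP _ b0); split.
- by move=> x; rewrite in_itv/= => /andP[/cont].
- move: s0; rewrite le_eqVlt => /predU1P[<-|s0].
    under eq_fun do rewrite powRr0.
    by rewrite powRr0; exact: cvg_cst.
  by rewrite powR0 ?gt_eqF//; exact: powR_cvg0.
- by apply: cvg_at_left_filter; exact: cont.
Qed.

Let mu := @lebesgue_measure R.

Lemma gamma_kernel_by_parts s b : 1 <= s -> 0 < b ->
  (\int[mu]_(y in `[0%R, b]) (gamma_kernel (s + 1) y)%:E
     + (b `^ s * expR (- b))%:E
   = s%:E * \int[mu]_(y in `[0%R, b]) (gamma_kernel s y)%:E)%E.
Proof.
move=> s1 b0.
have s0 : 0 < s by exact: lt_le_trans s1.
have cexpN : continuous (fun y : R => expR (- y)).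
  by move=> x; apply: continuous_comp; [exact: continuousN|exact: continuous_expR].
have dexpN (x : R) : is_derive x 1 (fun y : R => - expR (- y)) (expR (- x)).
  by apply: is_derive_eq; rewrite mulrN1 opprK.
have cpow := @continuous_powR0 s b (ltW s0) b0.
have [_ cpow0 cpowb] := (continuous_within_itvP _ b0).1 cpow.
have s10 : 0 <= s - 1 by rewrite subr_ge0.
have mK := measurable_EFin_gamma_kernel.
have eqI : (\int[mu]_(y in `[0%R, b]) (y `^ s * expR (- y))%:E
    = (- (b `^ s * expR (- b)))%:E
      + s%:E * \int[mu]_(y in `[0%R, b]) (gamma_kernel s y)%:E)%E.
  rewrite (@integration_by_parts R (fun y => y `^ s) (fun y => - expR (- y))
    (fun y => s * y `^ (s - 1)) (fun y => expR (- y)) 0 b b0).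
  - rewrite powR0 ?gt_eqF// mul0r subr0 mulrN -ge0_integralZl//; first last.
    + by rewrite lee_fin ltW.
    + by move=> y _; rewrite lee_fin gamma_kernel_ge0.
    + exact: mK.
    congr (_ + _)%E; apply: oppe_inj; rewrite oppeK -integral_ge0N.
      by apply: eq_integral => y _; rewrite -EFinM -EFinN /gamma_kernel; congr EFin; ring.
    by move=> y _; rewrite mule_ge0 ?lee_fin ?gamma_kernel_ge0// (ltW s0).
  - move=> x; apply: cvgM; first exact: cvg_cst.
    exact: continuous_powR0.
  - split => //; move=> x; rewrite in_itv/= => /andP[x0 _].
    by apply: derivable_powR; rewrite in_itv/= andbT.
  - by move=> x; rewrite in_itv/= => /andP[x0 _]; rewrite powR_derive1// in_itv/= andbT.
  - exact: continuous_subspaceT.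
  - split.
    + move=> x _; exact: ex_derive.
    + by apply: cvg_at_right_filter; apply: cvgN; exact: cexpN.
    + by apply: cvg_at_left_filter; apply: cvgN; exact: cexpN.
  - by move=> x _; rewrite derive1E; exact: derive_val.
have -> : (\int[mu]_(y in `[0%R, b]) (gamma_kernel (s + 1) y)%:E =
    \int[mu]_(y in `[0%R, b]) (y `^ s * expR (- y))%:E)%E.
  by apply: eq_integral => y _; rewrite /gamma_kernel addrK.
by rewrite eqI addeAC -EFinD addNr add0e.
Qed.

(** Integrate by parts on [[0, b]] and let [b] tend to infinity.  The identity
holds in the extended reals, so it can be used to prove finiteness. *)
Lemma gamma_integral_rec s : 1 <= s ->
  (\int[mu]_(y in `]0%R, +oo[) (gamma_kernel (s + 1) y)%:E
   = s%:E * \int[mu]_(y in `]0%R, +oo[) (gamma_kernel s y)%:E)%E.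
Proof.
move=> s1.
have mK := measurable_EFin_gamma_kernel.
have lim r : (\int[mu]_(y in `[0%R, n.+1%:R]) (gamma_kernel r y)%:E)%E @[n --> \oo]
    --> (\int[mu]_(y in `]0%R, +oo[) (gamma_kernel r y)%:E)%E.
  rewrite (integral_itv_obnd_cbnd (mK _ _)).
  have -> : `[0, +oo[%classic = \bigcup_n `[0, n.+1%:R]%classic :> set R.
    apply/seteqP; split => x /=.
      rewrite in_itv/= andbT => x0; exists (Num.truncn x) => //=.
      by rewrite in_itv/= x0 ltW// truncnS_gt.
    by move=> [n _ /=]; rewrite !in_itv/= andbT => /andP[].
  apply: ge0_nondecreasing_set_cvg_integral => //.
  - move=> n m nm; apply/subsetPset => x /=; rewrite !in_itv/= => /andP[-> /=].
    by move=> /le_trans; apply; rewrite ler_nat.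
  - by move=> n; exact: mK.
  - by move=> n y _; rewrite lee_fin gamma_kernel_ge0.
have bdry : (n.+1%:R `^ s * expR (- n.+1%:R))%:E @[n --> \oo] --> (0 : \bar R)%E.
  apply/fine_cvgP; split; first exact: nearW.
  have [C C0 HC] := powR_expRN_bound s.
  apply: (@squeeze_cvgr _ _ _ _ (fun=> 0) (fun n => C / n.+1%:R)).
  - near=> n; rewrite /= mulr_ge0 ?powR_ge0 ?expR_ge0//=.
    by apply: HC; rewrite ler1n.
  - exact: cvg_cst.
  - rewrite -[X in _ --> X](mulr0 C); apply: cvgM; first exact: cvg_cst.
    exact: cvg_harmonic.
have <- : limn (fun n => s%:E * \int[mu]_(y in `[0%R, n.+1%:R]) (gamma_kernel s y)%:E)%E
    = (s%:E * \int[mu]_(y in `]0%R, +oo[) (gamma_kernel s y)%:E)%E.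
  by apply/cvg_lim => //; exact: cvgeZl.
apply/esym/cvg_lim => //.
under eq_fun do rewrite -gamma_kernel_by_parts//.
have /cvgeD/(_ (lim (s + 1)) bdry) : (\int[mu]_(y in `]0%R, +oo[)
    (gamma_kernel (s + 1) y)%:E +? 0)%E by rewrite fin_num_adde_defl.
by rewrite adde0.
Unshelve. all: by end_near. Qed.

Let nu : {measure set (lebesgueTypeR R) -> \bar R} := @completed_lebesgue_measure R.

Lemma measurable_completed (D : set R) (f : R -> \bar R) :
  measurable D -> measurable_fun D f ->
  measurable_fun (D : set (lebesgueTypeR R)) (f : lebesgueTypeR R -> \bar R).
Proof. by move=> mD mf _ A mA; apply: sub_caratheodory; exact: mf. Qed.

Lemma measurable_0oo : measurable (`]0, +oo[ : set (lebesgueTypeR R)).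
Proof. by apply: sub_caratheodory; exact: measurable_itv. Qed.

(** The Lebesgue measure on Borel sets is the image of the completed one by the
identity, so integrals of Borel functions do not see the completion. *)
Lemma ge0_integral_completed (D : set R) (f : R -> \bar R) :
  measurable D -> measurable_fun D f -> (forall y, D y -> (0 <= f y)%E) ->
  (\int[nu]_(y in (D : set (lebesgueTypeR R))) f y = \int[mu]_(y in D) f y)%E.
Proof.
move=> mD mf f0.
have mid : measurable_fun [set: lebesgueTypeR R] (id : lebesgueTypeR R -> measurableTypeR R).
  by move=> _ A mA; rewrite setTI; exact: sub_caratheodory.
have <- : (pushforward nu (id : lebesgueTypeR R -> measurableTypeR R)) = mu.
  exact/funext.
apply/esym/(@ge0_integral_pushforward _ _ _ (measurableTypeR R) _ _ mid nu D f mD mf).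
by move=> y; rewrite inE; exact: f0.
Qed.

(** Integer parameters follow from the recurrence, starting with the exponential
distribution; for real [s], [y `^ (s - 1)] is at most [1 + y `^ n] with [n] the
integer part of [s]. *)
Lemma gamma_kernel_integral_fin s : 1 <= s ->
  (\int[mu]_(y in `]0%R, +oo[) (gamma_kernel s y)%:E < +oo)%E.
Proof.
have mK := measurable_EFin_gamma_kernel.
have natfin n : (\int[mu]_(y in `]0%R, +oo[) (gamma_kernel n.+1%:R y)%:E < +oo)%E.
  elim: n => [|n IH]; last first.
    by rewrite -natr1 gamma_integral_rec ?ler1n// lte_mul_pinfty ?lee_fin.
  rewrite (integral_itv_obnd_cbnd (mK _ _)).
  have := integral_exponential_pdf (@ltr01 R).
  rewrite (_ : (fun x => _) = ((fun y => (gamma_kernel 1 y)%:E) \_ `[0, +oo[)).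
    by rewrite -integral_mkcond => ->; rewrite ltry.
  apply/funext => x; rewrite /exponential_pdf !patchE; case: ifP => // _.
  by rewrite /gamma_kernel subrr powRr0 mulN1r.
move=> s1; set n := Num.truncn s.
have sn : s <= n.+1%:R by exact/ltW/truncnS_gt.
apply: (@le_lt_trans _ _ (\int[mu]_(y in `]0%R, +oo[)
   ((gamma_kernel 1 y)%:E + (gamma_kernel n.+1%:R y)%:E))%E).
  apply: ge0_le_integral => //.
  - by move=> y _; rewrite lee_fin gamma_kernel_ge0.
  - exact: mK.
  - exact: (emeasurable_funD (mK _ _) (mK _ _)).
  - move=> y; rewrite /= in_itv/= andbT => y0.
    rewrite -EFinD lee_fin /gamma_kernel -mulrDl ler_pM2r ?expR_gt0//.
    rewrite subrr powRr0; have [y1|/ltW y1] := leP y 1.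
      apply: ler_wpDr; first exact: powR_ge0.
      by rewrite -[leRHS](powRr0 y); apply: ger_powR; rewrite ?y0 ?subr_ge0.
    by apply: ler_wpDl => //; rewrite ler_powR// lerD2r.
rewrite ge0_integralD//=.
- by apply: lte_add_pinfty; [exact: (natfin 0%N)|exact: natfin].
- by move=> y _; rewrite lee_fin gamma_kernel_ge0.
- exact: mK.
- by move=> y _; rewrite lee_fin gamma_kernel_ge0.
- exact: mK.
Qed.

Lemma integrable_gamma_kernel s : 1 <= s ->
  nu.-integrable (`]0, +oo[ : set (lebesgueTypeR R)) (EFin \o gamma_kernel s).
Proof.
move=> s1; have mK := measurable_EFin_gamma_kernel s `]0, +oo[.
apply/integrableP; split; first exact: measurable_completed.
under eq_integral do rewrite /= ger0_norm ?gamma_kernel_ge0//.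
rewrite ge0_integral_completed//; first exact: gamma_kernel_integral_fin.
by move=> y _; rewrite lee_fin gamma_kernel_ge0.
Qed.

Lemma GammaE s : 1 <= s ->
  (Gamma s)%:E = (\int[mu]_(y in `]0%R, +oo[) (gamma_kernel s y)%:E)%E.
Proof.
move=> s1; rewrite /Gamma /integral_0oo /Rintegral fineK; last first.
  apply: (integrable_fin_num measurable_0oo).
  exact: (integrable_gamma_kernel s s1).
rewrite ge0_integral_completed//; first exact: measurable_EFin_gamma_kernel.
by move=> y _; rewrite lee_fin gamma_kernel_ge0.
Qed.

Lemma GammaD1 s : 1 <= s -> Gamma (s + 1) = s * Gamma s.
Proof.
move=> s1; apply: EFin_inj; rewrite EFinM !GammaE//.
  exact: gamma_integral_rec.
by rewrite ler_wpDr.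
Qed.

(** The integrand is at least [expR (- 2)] on [[1, 2]]. *)
Lemma Gamma_gt0 s : 1 <= s -> 0 < Gamma s.
Proof.
move=> s1; have mK := measurable_EFin_gamma_kernel s.
rewrite -lte_fin GammaE//.
apply: (@lt_le_trans _ _ (\int[mu]_(y in `[1%R, 2%R]) (expR (- 2))%:E)%E).
  rewrite integral_cst//= /mu lebesgue_measure_itv/= lte_fin ltr1n.
  by rewrite -EFinD -EFinM lte_fin mulr_gt0 ?expR_gt0// subr_gt0 ltr1n.
apply: (@le_trans _ _ (\int[mu]_(y in `[1%R, 2%R]) (gamma_kernel s y)%:E)%E).
  apply: ge0_le_integral => //.
  - exact: mK.
  - move=> y; rewrite /= in_itv/= => /andP[y1 y2]; rewrite lee_fin /gamma_kernel.
    rewrite -[leLHS]mul1r; apply: ler_pM; rewrite ?expR_ge0 ?ler_expR ?lerN2//.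
    by rewrite -[leLHS](powRr0 y) ler_powR// subr_ge0.
apply: ge0_subset_integral => //.
- exact: mK.
- by move=> y _; rewrite lee_fin gamma_kernel_ge0.
- by move=> y; rewrite /= !in_itv/= andbT => /andP[/(lt_le_trans ltr01)].
Qed.

(** A list of pairs [(c, s)] encodes the linear combination of the gamma integrands
of parameters [s] with coefficients [c]; both envelopes are of this form. *)
Lemma gamma_kernel_sum (L : seq (R * R)) : (forall p, p \in L -> 1 <= p.2) ->
  nu.-integrable (`]0, +oo[ : set (lebesgueTypeR R))
    (fun y => (\sum_(p <- L) p.1 * gamma_kernel p.2 y)%:E) /\
  integral_0oo (fun y => \sum_(p <- L) p.1 * gamma_kernel p.2 y) =
  \sum_(p <- L) p.1 * Gamma p.2.
Proof.
elim: L => [_|[c s] L IH H].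
  split.
    apply: (eq_integrable measurable_0oo (cst 0%E)); last exact: integrable0.
    by move=> y _; rewrite big_nil.
  rewrite big_nil /integral_0oo /Rintegral integral0_eq// => y _.
  by rewrite big_nil.
have s1 : 1 <= s by apply: (H (c, s)); rewrite inE eqxx.
have [|fi fE] := IH; first by move=> p pL; apply: H; rewrite inE pL orbT.
have si := integrable_gamma_kernel s s1.
have ci : nu.-integrable (`]0, +oo[ : set (lebesgueTypeR R))
    (fun y => (c * gamma_kernel s y)%:E).
  exact: (integrableZl measurable_0oo c si).
split.
  apply: (eq_integrable measurable_0oo) (integrableD measurable_0oo ci fi) => y _.
  by rewrite big_cons EFinD.
rewrite big_cons -fE -(RintegralZl _ measurable_0oo si).
rewrite -(RintegralD measurable_0oo ci fi).
by apply: eq_Rintegral => y _; rewrite big_cons.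
Qed.

(** The two outer integrals force the integral of [f] to be finite, without which
its real value would carry no information. *)
Lemma integral_0oo_sandwich L1 L2 f :
  (forall p, p \in L1 -> 1 <= p.2) -> (forall p, p \in L2 -> 1 <= p.2) ->
  (forall y, 0 < y -> \sum_(p <- L1) p.1 * gamma_kernel p.2 y <= f y
                        <= \sum_(p <- L2) p.1 * gamma_kernel p.2 y) ->
  \sum_(p <- L1) p.1 * Gamma p.2 <= integral_0oo f
    <= \sum_(p <- L2) p.1 * Gamma p.2.
Proof.
move=> h1 h2 h; have [i1 <-] := gamma_kernel_sum _ h1; have [i2 <-] := gamma_kernel_sum _ h2.
have le1 : (\int[nu]_(y in (`]0%R, +oo[ : set (lebesgueTypeR R)))
    (\sum_(p <- L1) p.1 * gamma_kernel p.2 y)%:E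
    <= \int[nu]_(y in (`]0%R, +oo[ : set (lebesgueTypeR R))) (f y)%:E)%E.
  apply: le_integral_mono => y /=; rewrite in_itv/= andbT => y0.
  by rewrite lee_fin; case/andP: (h y y0).
have le2 : (\int[nu]_(y in (`]0%R, +oo[ : set (lebesgueTypeR R))) (f y)%:E <=
    \int[nu]_(y in (`]0%R, +oo[ : set (lebesgueTypeR R)))
    (\sum_(p <- L2) p.1 * gamma_kernel p.2 y)%:E)%E.
  apply: le_integral_mono => y /=; rewrite in_itv/= andbT => y0.
  by rewrite lee_fin; case/andP: (h y y0).
have fin1 := integrable_fin_num measurable_0oo i1.
have fin2 := integrable_fin_num measurable_0oo i2.
have fin : (\int[nu]_(y in (`]0%R, +oo[ : set (lebesgueTypeR R))) (f y)%:E)%E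
    \is a fin_num.
  rewrite fin_numE; apply/andP; split.
    by rewrite gt_eqF// (lt_le_trans _ le1)// ltNye_eq fin1.
  by rewrite lt_eqF// (le_lt_trans le2)// ltey_eq fin2.
by apply/andP; split; exact: fine_le.
Qed.

(** * The asymptotic equivalence *)

(** Multiplying a gamma integrand by [y] raises its parameter by 1, so the powers
of [z = y / Q] in the envelopes shift the parameter [Q], and the recurrence of
[Gamma] expresses everything through [Gamma Q]. *)
Lemma gamma_integral_bounds l (Q v eta C : R) : 3 <= Q -> 0 < eta ->
  (forall z, 0 < z ->
    l v / (1 + eta) * (1 - 4 * (z - 1) ^+ 2) <= l (v / z)
      <= l v * (1 + eta + C * ((z + z^-1) * (z - 1) ^+ 2))) ->
  Gamma Q * l v * ((1 - 4 / Q) / (1 + eta)) <=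
  integral_0oo (fun y => y `^ (Q - 1) * expR (- y) * l (v * Q / y))
   <= Gamma Q * l v * (1 + eta + C * (1 / Q + 2 / Q ^+ 2 + 1 / (Q - 1))).
Proof.
move=> Q3 eta0 H.
have Q0 : 0 < Q by lra.
have e0 : 0 < 1 + eta by lra.
pose m := l v / (1 + eta).
(* Expansions of m (1 - 4 (z - 1)^2) and of
   l v (1 + eta + C (z^3 - 2 z^2 + 2 z - 2 + z^-1)), with z = y / Q. *)
pose L1 : seq (R * R) := [:: (- 3 * m, Q); (8 * m / Q, Q + 1);
  (- 4 * m / Q ^+ 2, Q + 1 + 1)].
pose L2 : seq (R * R) := [:: (l v * (1 + eta - 2 * C), Q); (2 * (l v * C) / Q, Q + 1);
  (- 2 * (l v * C) / Q ^+ 2, Q + 1 + 1);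
  (l v * C / Q ^+ 3, Q + 1 + 1 + 1); (l v * C * Q, Q - 1)].
have H1 p : p \in L1 -> 1 <= p.2.
  by rewrite !inE => /orP[|/orP[|]] /eqP-> /=; lra.
have H2 p : p \in L2 -> 1 <= p.2.
  by rewrite !inE => /orP[|/orP[|/orP[|/orP[|]]]] /eqP-> /=; lra.
have Q10 : Q - 1 != 0 by rewrite gt_eqF//; lra.
have -> : Gamma Q * l v * ((1 - 4 / Q) / (1 + eta)) = \sum_(p <- L1) p.1 * Gamma p.2.
  rewrite !big_cons big_nil/= !GammaD1; [|lra..].
  by rewrite /m; field; rewrite !gt_eqF.
have -> : Gamma Q * l v * (1 + eta + C * (1 / Q + 2 / Q ^+ 2 + 1 / (Q - 1)))
    = \sum_(p <- L2) p.1 * Gamma p.2.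
  have GQ : Gamma Q = (Q - 1) * Gamma (Q - 1) by rewrite -GammaD1 ?subrK//; lra.
  rewrite !big_cons big_nil/= !GammaD1; [|lra..].
  by rewrite GQ; field; rewrite Q10 gt_eqF.
apply: (@integral_0oo_sandwich L1 L2 _ H1 H2) => y y0.
have yz : v * Q / y = v / (y / Q) by rewrite invf_div mulrA.
have z0 : 0 < y / Q by rewrite divr_gt0.
have /andP[h1 h2] := H _ z0.
rewrite yz -/(gamma_kernel Q y).
have K0 := gamma_kernel_ge0 Q y.
rewrite !big_cons !big_nil/= !gamma_kernelD1//; apply/andP; split.
  apply: le_trans (ler_wpM2l K0 h1).
  by rewrite le_eqVlt -/m; apply/orP; left; apply/eqP; field; rewrite gt_eqF.
apply: (le_trans (ler_wpM2l K0 h2)).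
have -> : gamma_kernel Q y = y * gamma_kernel (Q - 1) y by rewrite -gamma_kernelD1// subrK.
rewrite le_eqVlt; apply/orP; left; apply/eqP; field.
by rewrite !gt_eqF.
Qed.

End gamma.

Theorem lemma3p1 (R : realType) (l q : R -> R)
    (l_gt0 : forall x : R, 0 < x -> 0 < l x)
    (l_meas : lebesgue_measurable_fun `]0, +oo[ l)
    (l_locbnd : [locally [bounded l x | x in `[0, +oo[]])
    (l_sv : slowly_varying l)
    (q_gt0 : \forall t \near +oo, 0 < q t)
    (q_o : q t / t @[t --> +oo] --> (0 : R))
    (q_oo : q t @[t --> +oo] --> +oo) :
  asymp_equiv
    (fun t => integral_0oo
                (fun y => y `^ (q t - 1) * expR (- y) * l (t / y)))
    (fun t => Gamma (q t) * l (t / q t)).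
Proof.
apply/cvgrPdist_le => e e0.
pose eta := e / 2; have eta0 : 0 < eta by rewrite divr_gt0.
have [V1 V10 HV1] := slowly_varying_lower l l_gt0 l_meas l_sv eta eta0.
have [C C0 [V2 V20 HV2]] := slowly_varying_upper l l_gt0 l_meas l_sv eta l_locbnd eta0.
pose V := Num.max V1 V2; have V0 : 0 < V by rewrite lt_max V10.
near=> t.
have t0 : 0 < t by near: t; exact: nbhs_pinfty_gt.
have Q3 : 3 <= q t by near: t; move/cvgryPge : q_oo; exact.
(* The next two thresholds give [C * (4 / (Q - 1)) <= eta] and [4 / Q <= eta]. *)
have QC : 1 + 4 * C / eta <= q t by near: t; move/cvgryPge : q_oo; exact.
have Qe : 4 / eta <= q t by near: t; move/cvgryPge : q_oo; exact.
have vV : V <= t / q t.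
  have : `|0 - q t / t| <= V^-1.
    by near: t; move/cvgrPdist_le : q_o; apply; rewrite invr_gt0.
  have Q0 : 0 < q t by lra.
  have tq0 : 0 < t / q t by rewrite divr_gt0.
  rewrite sub0r normrN -[q t / t]invf_div ger0_norm ?invr_ge0; last exact: ltW.
  by rewrite lef_pV2 ?posrE.
set Q := q t in Q3 QC Qe vV *; set v := t / Q in vV *.
have Q0 : 0 < Q by lra.
have tE : t = v * Q by rewrite /v divfK ?gt_eqF.
have v0 : 0 < v by exact: lt_le_trans vV.
have lv := l_gt0 _ v0.
have GQ : 0 < Gamma Q by apply: Gamma_gt0; lra.
have GL : 0 < Gamma Q * l v by rewrite mulr_gt0.
have [V1v V2v] : V1 <= v /\ V2 <= v by move: vV; rewrite /V ge_max => /andP.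
have /andP[] : Gamma Q * l v * ((1 - 4 / Q) / (1 + eta)) <=
    integral_0oo (fun y => y `^ (Q - 1) * expR (- y) * l (t / y))
   <= Gamma Q * l v * (1 + eta + C * (1 / Q + 2 / Q ^+ 2 + 1 / (Q - 1))).
  rewrite tE; apply: (@gamma_integral_bounds R l Q v eta C) => // z z0.
  by rewrite HV1//= HV2.
set I := integral_0oo _ => I1 I2.
set r := I / _.
have IE : I = Gamma Q * l v * r by rewrite /r mulrC divfK ?gt_eqF.
move: I1 I2; rewrite IE !ler_pM2l// => r1 r2.
have lower : 1 - e <= r.
  apply: le_trans r1; rewrite ler_pdivlMr; last lra.
  have Qi : 4 / Q <= eta.
    by rewrite ler_pdivrMr// mulrC -ler_pdivrMr.
  have -> : e = 2 * eta by rewrite /eta; field.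
  nra.
have upper : r <= 1 + e.
  apply: (le_trans r2).
  have Q1 : 0 < Q - 1 by lra.
  have b1 : 1 / Q <= (Q - 1)^-1 by rewrite div1r lef_pV2 ?posrE//; lra.
  have b2 : 2 / Q ^+ 2 <= 2 * (Q - 1)^-1.
    rewrite ler_pM2l// lef_pV2 ?posrE ?exprn_gt0//; nra.
  have Qi : C * (4 * (Q - 1)^-1) <= eta.
    have h : 4 * C <= (Q - 1) * eta by rewrite -ler_pdivrMr//; lra.
    have -> : C * (4 * (Q - 1)^-1) = 4 * C / (Q - 1) by ring.
    by rewrite ler_pdivrMr// [leRHS]mulrC.
  have : C * (1 / Q + 2 / Q ^+ 2 + 1 / (Q - 1)) <= C * (4 * (Q - 1)^-1).
    rewrite ler_pM2l//; lra.
  have -> : e = 2 * eta by rewrite /eta; field.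
  lra.
by rewrite ler_norml; apply/andP; split; lra.
Unshelve. all: by end_near. Qed.
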